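(* Let $f:\mathbb{R}^n\to\mathbb{R}$, $x_0\in\mathbb{R}^n$ and $\delta_{\max}>0$ be such that $f$ is twice continuously differentiable in an open set containing $L_{enl}(x_0)$, $\nabla^2 f$ is Lipschitz continuous with constant $\kappa_{Lh}$ and $\|\nabla^2 f\|$ is bounded by a constant $\kappa_{bhf}$ on $L_{enl}(x_0)$, and $f$ is bounded from below on $L(x_0)$. Consider the second order trust-region algorithm with random models described in the context, with parameters $\eta_1\in(0,1)$, $\eta_2>0$, $\gamma>1$, $\delta_{\max}$, where for all realizations every step achieves a fraction of optimal decrease with a fixed constant $\kappa_{fod}\in(0,1]$. Suppose that the model sequence $\{M_k\}$ is probabilistically $(\kappa_{eh},\kappa_{eg},\kappa_{ef})$-fully quadratic for some positive constants $\kappa_{eh}$, $\kappa_{eg}$ and $\kappa_{ef}$. Let $\{X_k\}$ be the sequence of random iterates generated by the algorithm. Then, almost surely, $$\liminf_{k\to\infty}\tau(X_k) \;=\; 0 .$$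
   Context: Notation: $\|\cdot\|$ is the Euclidean norm for vectors and the induced norm for matrices; $\lambda_{\min}$ is the smallest eigenvalue; $B(x,\delta)$ is the closed ball of center $x$ and radius $\delta$. $L(x_0)=\{x\in\mathbb{R}^n: f(x)\le f(x_0)\}$ and $L_{enl}(x_0)=\bigcup_{x\in L(x_0)}B(x,\delta_{\max})$. A ratio with zero denominator inside a $\min$ is interpreted as $+\infty$. Models: at iteration $k$ the model is a quadratic function written as $m_k(x_k+s)=m_k(x_k)+s^\top g_k+\frac12 s^\top H_k s$, with $g_k=\nabla m_k(x_k)$ and $H_k=\nabla^2 m_k(x_k)$ symmetric. No uniform bound on $\|H_k\|$ is assumed. Second order stationarity measures: $$\tau(x)=\max\left\{\min\left[\|\nabla f(x)\|,\frac{\|\nabla f(x)\|}{\|\nabla^2 f(x)\|}\right],-\lambda_{\min}(\nabla^2 f(x))\right\},\qquad \tau^m_k=\max\left\{\min\left[\|g_k\|,\frac{\|g_k\|}{\|H_k\|}\right],-\lambda_{\min}(H_k)\right\}.$$ Fraction of optimal decrease: the step $s_k\in B(0,\delta_k)$ satisfies $$m_k(x_k)-m_k(x_k+s_k)\ge\frac{\kappa_{fod}}{2}\max\left\{\|g_k\|\min\left[\frac{\|g_k\|}{\|H_k\|},\delta_k\right],\ \max\{-\lambda_{\min}(H_k),0\}\,\delta_k^2\right\}.$$ Second order trust-region algorithm: $x_0$ and $0<\delta_0\le\delta_{\max}$ are given. At iteration $k=0,1,2,\dots$, approximate $f$ in $B(x_k,\delta_k)$ by a model $m_k$ and compute a step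 $s_k\in B(0,\delta_k)$ achieving a fraction of optimal decrease. Let $\rho_k=\frac{f(x_k)-f(x_k+s_k)}{m_k(x_k)-m_k(x_k+s_k)}$. If $\rho_k\ge\eta_1$ and $\tau^m_k\ge\eta_2\delta_k$, set $x_{k+1}=x_k+s_k$ and $\delta_{k+1}=\min\{\gamma\delta_k,\delta_{\max}\}$. Otherwise set $x_{k+1}=x_k$ and $\delta_{k+1}=\gamma^{-1}\delta_k$. (If the denominator of $\rho_k$ is zero, the condition on $\tau^m_k$ fails, so $\rho_k$ is irrelevant.) Randomness: the models are random, denoted $M_k$, with realizations $m_k=M_k(\omega)$; $X_k$, $\Delta_k$ denote the resulting random iterates and trust-region radii, with realizations $x_k,\delta_k$. $M_k$ encompasses all the randomness of iteration $k$, so $X_k$ and $\Delta_k$ are determined by $M_0,\dots,M_{k-1}$. Fully quadratic: $m_k$ is a $(\kappa_{eh},\kappa_{eg},\kappa_{ef})$-fully quadratic model of $f$ on $B(x_k,\delta_k)$ if for every $s\in B(0,\delta_k)$: $\|\nabla^2 f(x_k+s)-H_k\|\le\kappa_{eh}\delta_k$, $\|\nabla f(x_k+s)-\nabla m_k(x_k+s)\|\le\kappa_{eg}\delta_k^2$, and $|f(x_k+s)-m_k(x_k+s)|\le\kappa_{ef}\delta_k^3$. Probabilistically fully quadratic: $\{M_k\}$ is probabilistically $(\kappa_{eh},\kappa_{eg},\kappa_{ef})$-fully quadratic (for the corresponding sequence $\{B(X_k,\Delta_k)\}$) if, for some $p\ge\frac12$, the events $S_k=\{M_k$ is a $(\kappa_{eh},\kappa_{eg},\kappa_{ef})$-fully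 quadratic model of $f$ on $B(X_k,\Delta_k)\}$ satisfy $P(S_k\mid F^M_{k-1})\ge p$ for every $k$, where $F^M_{k-1}=\sigma(M_0,\dots,M_{k-1})$. *)

(* Defs.v *)
From HB Require Import structures.
From mathcomp Require Import all_boot all_order all_algebra.
From mathcomp Require Import all_classical all_reals all_analysis.
From mathcomp Require Import ring.

Set Implicit Arguments.
Unset Strict Implicit.
Unset Printing Implicit Defensive.

Import Order.TTheory GRing.Theory Num.Theory.
Import numFieldNormedType.Exports.

Local Open Scope classical_set_scope.
Local Open Scope ring_scope.

(* Vectors of R^n are row vectors.  The library's norm on ['rV[R]_n] is the
   max norm; it induces the usual topology and the usual notion of
   differentiability, but the Euclidean norm has to be defined. *)

Definition dotp (R : realType) (n : nat) (u v : 'rV[R]_n) : R :=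
  \sum_(i < n) u 0 i * v 0 i.

Definition enorm (R : realType) (n : nat) (u : 'rV[R]_n) : R :=
  Num.sqrt (dotp u u).

(* Matrices act on row vectors from the right; a matrix and its transpose have
   the same induced norm. *)
Definition opnorm (R : realType) (n : nat) (A : 'M[R]_n) : R :=
  sup [set enorm (v *m A) | v in [set v : 'rV[R]_n | enorm v <= 1]].

(* For a symmetric matrix of positive size the set of (real) eigenvalues is
   finite and nonempty, so that the infimum is a minimum. *)
Definition lambda_min (R : realType) (n : nat) (A : 'M[R]_n) : R :=
  inf [set a : R | eigenvalue A a].

Definition eball (R : realType) (n : nat) (x : 'rV[R]_n) (r : R) :
    set 'rV[R]_n :=
  [set y | enorm (y - x) <= r].

Definition gradient (R : realType) (n : nat) (f : 'rV[R]_n -> R)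
    (x : 'rV[R]_n) : 'rV[R]_n :=
  \row_(i < n) 'D_(delta_mx 0 i) f x.

Definition hessian (R : realType) (n : nat) (f : 'rV[R]_n -> R)
    (x : 'rV[R]_n) : 'M[R]_n :=
  jacobian (gradient f) x.

Definition C2_on (R : realType) (n : nat) (U : set 'rV[R]_n)
    (f : 'rV[R]_n -> R) : Prop :=
  forall x, U x -> [/\ differentiable f x, differentiable (gradient f) x
                     & {for x, continuous (hessian f)}].

Definition levelset (R : realType) (n : nat) (f : 'rV[R]_n -> R)
    (x0 : 'rV[R]_n) : set 'rV[R]_n :=
  [set x | f x <= f x0].

Definition levelset_enl (R : realType) (n : nat) (f : 'rV[R]_n -> R)
    (x0 : 'rV[R]_n) (dmax : R) : set 'rV[R]_n :=
  \bigcup_(x in levelset f x0) eball x dmax.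

(* min [c, a / b], where a / 0 stands for +oo (even when a = 0). *)
Definition min_ratio (R : realType) (c a b : R) : R :=
  if b == 0 then c else Num.min c (a / b).

Definition stat_measure (R : realType) (n : nat) (g : 'rV[R]_n)
    (H : 'M[R]_n) : R :=
  Num.max (min_ratio (enorm g) (enorm g) (opnorm H)) (- lambda_min H).

Definition tau (R : realType) (n : nat) (f : 'rV[R]_n -> R)
    (x : 'rV[R]_n) : R :=
  stat_measure (gradient f x) (hessian f x).

Lemma dotpE (R : realType) (n : nat) (u v : 'rV[R]_n) :
  dotp u v = (u *m v^T) 0 0.
Proof. by rewrite mxE; apply: eq_bigr => i _; rewrite mxE. Qed.

(* A quadratic model is given by its value, gradient and (symmetric) Hessian at
   the current iterate [x]; [gradient_model_fun] and [hessian_model_fun] below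
   show that these are the derivatives of the quadratic function. *)
Record qmodel (R : realType) (n : nat) := QModel {
  mval : R;
  mgrad : 'rV[R]_n;
  mhess : 'M[R]_n;
  mhess_sym : mhess^T = mhess
}.

Definition model_fun (R : realType) (n : nat) (m : qmodel R n) (x : 'rV[R]_n) :
    'rV[R]_n -> R :=
  fun y => mval m + dotp (y - x) (mgrad m)
           + 2^-1 * dotp ((y - x) *m mhess m) (y - x).

Lemma gradient_model_fun (R : realType) (n : nat) (m : qmodel R n)
    (x y : 'rV[R]_n) :
  gradient (model_fun m x) y = mgrad m + (y - x) *m mhess m.
Proof.
have dC (u v : 'rV[R]_n) : dotp u v = dotp v u.
  by apply: eq_bigr => i _; rewrite mulrC.
have dD (u v w : 'rV[R]_n) : dotp (u + v) w = dotp u w + dotp v w.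
  by rewrite !dotpE mulmxDl mxE.
have dZ a (u w : 'rV[R]_n) : dotp (a *: u) w = a * dotp u w.
  by rewrite !dotpE -scalemxAl mxE.
have dH (u v : 'rV[R]_n) : dotp (u *m mhess m) v = dotp (v *m mhess m) u.
  by rewrite dC !dotpE trmx_mul mhess_sym mulmxA.
apply/rowP => i; rewrite mxE.
set e : 'rV[R]_n := delta_mx 0 i.
have de u : dotp u e = u 0 i.
  rewrite /dotp (bigD1 i) //= big1 ?addr0 => [|j ji]; rewrite mxE eqxx /=.
    by rewrite eqxx mulr1.
  by rewrite (negbTE ji) mulr0.
set z := y - x; set B := 2^-1 * dotp (e *m mhess m) e.
rewrite -de; set A := dotp _ e.
have c0 : (fun h : R => A + h * B) @ 0^' --> A.
  have : (fun h : R => A + h * B) @ (0 : R) --> A + 0 * B.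
    by apply: cvgD; [exact: cvg_cst | apply: cvgMl; exact: cvg_id].
  rewrite mul0r addr0; apply: cvg_trans; apply: cvg_app; exact: cvg_within.
apply: cvg_lim => //; apply: cvg_trans c0.
apply: near_eq_cvg; near=> h.
have h0 : h != 0 by near: h; exact: nbhs_dnbhs_neq.
rewrite /model_fun /= -/e -/z.
have -> : h *: e + y - x = h *: e + z by rewrite /z addrA.
rewrite mulmxDl -scalemxAl.
have dDr (u v w : 'rV[R]_n) : dotp u (v + w) = dotp u v + dotp u w.
  by rewrite dC dD (dC v) (dC w).
have dZr a (u w : 'rV[R]_n) : dotp u (a *: w) = a * dotp u w by rewrite dC dZ dC.
rewrite /A /B; clear A B; clearbody z.
rewrite !(dD, dDr, dZ, dZr) (dC e (mgrad m)) (dH e z).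
rewrite /GRing.scale/=.
by field.
Unshelve. all: by end_near. Qed.

Lemma hessian_model_fun (R : realType) (n : nat) (m : qmodel R n)
    (x y : 'rV[R]_n) :
  hessian (model_fun m x) y = mhess m.
Proof.
rewrite /hessian.
have -> : gradient (model_fun m x) =
    cst (mgrad m - x *m mhess m) + \sum_(j < n) (fun z : 'rV[R]_n => z 0 j *: row j (mhess m)).
  apply/funext => z; rewrite gradient_model_fun mulmxBl addrA addrAC.
  by rewrite [RHS]/= fct_sumE [X in _ + X = _]mulmx_sum_row.
have dg j : differentiable (fun z : 'rV[R]_n => z 0 j *: row j (mhess m)) y.
  exact/differentiableZl/differentiable_coord.
apply/row_matrixP => i; rewrite !rowE -deriveEjacobian; last first.
  apply: differentiableD; first exact: differentiable_cst.
  by apply: differentiable_sum => j; exact: dg.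
set e := delta_mx 0 i; apply: cvg_lim => //; apply: cvg_near_cst; near=> h.
have h0 : h != 0 by near: h; exact: nbhs_dnbhs_neq.
rewrite /= !fct_sumE.
have -> : (fun k : 'rV[R]_n => \sum_(j < n) k 0 j *: row j (mhess m)) = mulmxr (mhess m).
  by apply/funext => k; rewrite /= -mulmx_sum_row.
set a := mgrad m - _.
have aE u : (cst a + mulmxr (mhess m)) u = a + u *m mhess m by [].
rewrite !aE.
rewrite mulmxDl -scalemxAl opprD addrACA subrr add0r addrK.
by rewrite scalerA mulVf// scale1r.
Unshelve. all: by end_near. Qed.

Definition tau_model (R : realType) (n : nat) (m : qmodel R n) : R :=
  stat_measure (mgrad m) (mhess m).

Definition frac_optimal_decrease (R : realType) (n : nat) (kfod : R)
    (m : qmodel R n) (x : 'rV[R]_n) (delta : R) (s : 'rV[R]_n) : Prop :=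
  model_fun m x x - model_fun m x (x + s) >=
  kfod / 2 * Num.max
    (enorm (mgrad m) * min_ratio delta (enorm (mgrad m)) (opnorm (mhess m)))
    (Num.max (- lambda_min (mhess m)) 0 * delta ^+ 2).

Definition fully_quadratic (R : realType) (n : nat) (keh keg kef : R)
    (f : 'rV[R]_n -> R) (m : qmodel R n) (x : 'rV[R]_n) (delta : R) : Prop :=
  forall s, eball 0 delta s ->
    [/\ opnorm (hessian f (x + s) - mhess m) <= keh * delta,
        enorm (gradient f (x + s) - gradient (model_fun m x) (x + s))
          <= keg * delta ^+ 2
      & `|f (x + s) - model_fun m x (x + s)| <= kef * delta ^+ 3].

(* When the denominator vanishes, [tr_ratio] is 0 by the convention a / 0 = 0. *)
Definition tr_ratio (R : realType) (n : nat) (f : 'rV[R]_n -> R)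
    (m : qmodel R n) (x s : 'rV[R]_n) : R :=
  (f x - f (x + s)) / (model_fun m x x - model_fun m x (x + s)).

Definition tr_accept (R : realType) (n : nat) (eta1 eta2 : R)
    (f : 'rV[R]_n -> R) (m : qmodel R n) (x : 'rV[R]_n) (delta : R)
    (s : 'rV[R]_n) : bool :=
  (tr_ratio f m x s >= eta1) && (tau_model m >= eta2 * delta).

(* [x], [delta], [m], [s] form a run of the second order trust-region
   algorithm. *)
Definition tr_run (R : realType) (n : nat) (eta1 eta2 gamma dmax kfod : R)
    (f : 'rV[R]_n -> R) (x0 : 'rV[R]_n) (delta0 : R)
    (x : nat -> 'rV[R]_n) (delta : nat -> R)
    (m : nat -> qmodel R n) (s : nat -> 'rV[R]_n) : Prop :=
  [/\ x 0 = x0, delta 0 = delta0 &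
    forall k : nat,
      [/\ eball 0 (delta k) (s k),
          frac_optimal_decrease kfod (m k) (x k) (delta k) (s k),
          x k.+1 = (if tr_accept eta1 eta2 f (m k) (x k) (delta k) (s k)
                    then x k + s k else x k)
        & delta k.+1 = (if tr_accept eta1 eta2 f (m k) (x k) (delta k) (s k)
                        then Num.min (gamma * delta k) dmax
                        else gamma^-1 * delta k)]].

Definition model_coords (R : realType) (n : nat) : set (qmodel R n -> R) :=
  [set (@mval R n)]
  `|` [set (fun m => mgrad m 0 i) | i in [set: 'I_n]]
  `|` [set (fun m => mhess m ij.1 ij.2) | ij in [set: 'I_n * 'I_n]].

Definition random_model (R : realType) (n : nat) (d : measure_display)
    (T : measurableType d) (M : T -> qmodel R n) : Prop :=
  forall c, model_coords c -> measurable_fun [set: T] (c \o M).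

(* Generators of the sigma-algebra sigma(M_0, ..., M_{k-1}), i.e. F^M_{k-1}
   (trivial for k = 0). *)
Definition past_events (R : realType) (n : nat) (T : Type)
    (M : nat -> T -> qmodel R n) (k : nat) : set (set T) :=
  [set A | exists j c B, [/\ (j < k)%N, model_coords c, measurable B
                           & A = (c \o M j) @^-1` B]].

(* [Z] is measurable for the sigma-algebra generated by [G]. *)
Definition measurable_wrt (R : realType) (T : pointedType)
    (G : set (set T)) (Z : T -> R) : Prop :=
  @measurable_fun _ _ (g_sigma_algebraType G) R setT Z.

(* [Z] is a version of the conditional probability P(E | sigma(G)). *)
Definition cond_prob_version (R : realType) (d : measure_display)
    (T : measurableType d) (P : probability T R) (G : set (set T))
    (E : set T) (Z : T -> R) : Prop :=
  [/\ measurable E, measurable_wrt G Z,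
      P.-integrable setT (EFin \o Z)
    & forall A, <<s G >> A ->
        (\int[P]_(w in A) (Z w)%:E = P (E `&` A))%E].

(* P(E | sigma(G)) >= p almost surely. *)
Definition cond_prob_ge (R : realType) (d : measure_display)
    (T : measurableType d) (P : probability T R) (G : set (set T))
    (E : set T) (p : R) : Prop :=
  exists2 Z, cond_prob_version P G E Z & {ae P, forall w, p <= Z w}.

Definition prob_fully_quadratic (R : realType) (n : nat)
    (d : measure_display) (T : measurableType d) (P : probability T R)
    (keh keg kef : R) (f : 'rV[R]_n -> R) (M : nat -> T -> qmodel R n)
    (X : nat -> T -> 'rV[R]_n) (Delta : nat -> T -> R) : Prop :=
  exists2 p : R, 2^-1 <= p &
    forall k, cond_prob_ge P (past_events M k)
      [set w | fully_quadratic keh keg kef f (M k w) (X k w) (Delta k w)] p.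

(* Main.v *)
Require Import Defs.
From HB Require Import structures.
From mathcomp Require Import all_boot all_order all_algebra.
From mathcomp Require Import all_classical all_reals all_analysis.
From mathcomp Require Import measurable_realfun ring lra.

(** Write delta_k for the trust-region radius and L for ln gamma.

    Every realization has delta_k -> 0: an accepted step decreases f by a
    multiple of delta_k ^ 3 (acceptance forces the stationarity measure of the
    model above eta2 * delta_k, and a fraction of optimal decrease turns this
    into decrease of f), while a rejected step contracts delta_k.  Hence
    f(x_k) + nu * delta_k ^ 3 is, for small nu, a Lyapunov function bounded
    below whose decrements dominate delta_k ^ 3 (sufficient_decrease_cvg0,
    radius_cvg0).

    On the other hand, if tau(x_k) stays above some e > 0 and delta_k is small,
    then every fully quadratic model makes the step accepted
    (near0_tr_accept), so that ln delta_k increases by L with conditional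
    probability at least 1/2, and never decreases by more than L.  The
    nonnegative variable V_k = ln dmax - ln delta_k, restricted to the event
    C_k that the run has been in this regime since time k0, then has
    nonincreasing expectation: C_k belongs to the past of M_k, so conditioning
    applies to it.  Fatou's lemma forbids a nonnegative sequence with bounded
    expectations from tending to +oo on an event of positive probability
    (supermartingale_escape).  As V_k does tend to +oo, the regime lasts
    forever with probability zero (trapped_null), and countably many choices
    of e and k0 exhaust the event that liminf tau(X_k) is positive.

    Two points need care.  The regime must be an event of the past, whereas tau
    is only a composite of suprema and eigenvalues; it is therefore described
    by an open set of points, whose preimage under X_k is measurable
    (open_preimage_wrt).  This open set is obtained from the predicate
    nonstationary, a form of the inequality e <= tau that is stable under
    perturbation of the gradient and of the Hessian
    (nonstationary_perturb).  The same stability serves twice: to pass from a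
    point to its neighbours, and to pass from f to a fully quadratic model. *)

Set Implicit Arguments.
Unset Strict Implicit.
Unset Printing Implicit Defensive.

Import Order.TTheory GRing.Theory Num.Theory.
Import numFieldNormedType.Exports.

Local Open Scope classical_set_scope.
Local Open Scope ring_scope.

(** * Euclidean and operator norms *)

Section Euclid.
Context {R : realType} {n : nat}.
Implicit Types (u v w : 'rV[R]_n) (A B : 'M[R]_n).

Lemma dotpC u v : dotp u v = dotp v u.
Proof. by apply: eq_bigr => i _; rewrite mulrC. Qed.

Lemma dotpDl u v w : dotp (u + v) w = dotp u w + dotp v w.
Proof. by rewrite !dotpE mulmxDl mxE. Qed.

Lemma dotpZl a u w : dotp (a *: u) w = a * dotp u w.
Proof. by rewrite !dotpE -scalemxAl mxE. Qed.

Lemma dotpDr u v w : dotp u (v + w) = dotp u v + dotp u w.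
Proof. by rewrite dotpC dotpDl !(dotpC u). Qed.

Lemma dotpZr a u w : dotp u (a *: w) = a * dotp u w.
Proof. by rewrite dotpC dotpZl dotpC. Qed.

Lemma dotp_ge0 u : 0 <= dotp u u.
Proof. by apply: sumr_ge0 => i _; rewrite -expr2 sqr_ge0. Qed.

Lemma dotp_eq0 u : dotp u u = 0 -> u = 0.
Proof.
move=> /eqP; rewrite psumr_eq0 => [/allP u0|i _]; last by rewrite -expr2 sqr_ge0.
apply/rowP => i; rewrite mxE; apply/eqP.
by have := u0 i (mem_index_enum _); rewrite mulf_eq0 orbb.
Qed.

Lemma dotp_gt0 u : u != 0 -> 0 < dotp u u.
Proof.
move=> u0; rewrite lt_def dotp_ge0 andbT; apply: contra u0 => /eqP u0.
by apply/eqP/dotp_eq0.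
Qed.

Lemma enorm_ge0 u : 0 <= enorm u. Proof. exact: sqrtr_ge0. Qed.

Lemma enormE u : enorm u ^+ 2 = dotp u u.
Proof. by rewrite sqr_sqrtr// dotp_ge0. Qed.

Lemma enorm0 : enorm (0 : 'rV[R]_n) = 0.
Proof. by rewrite /enorm /dotp big1 ?sqrtr0// => i _; rewrite mxE mul0r. Qed.

Lemma enorm_gt0 u : u != 0 -> 0 < enorm u.
Proof. by move=> u0; rewrite sqrtr_gt0 dotp_gt0. Qed.

Lemma enormZ a u : enorm (a *: u) = `|a| * enorm u.
Proof.
by rewrite /enorm dotpZl dotpZr mulrA -expr2 sqrtrM ?sqr_ge0// sqrtr_sqr.
Qed.

(** The squared length of (v . v) u - (u . v) v is nonnegative. *)
Lemma dotp_CauchySchwarz u v : dotp u v ^+ 2 <= dotp u u * dotp v v.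
Proof.
have [->|v0] := eqVneq v 0.
  by rewrite /dotp big1 ?expr0n ?mulr_ge0 ?dotp_ge0// => i _; rewrite mxE mulr0.
have vv := dotp_gt0 v0.
set w := dotp v v *: u + (- dotp u v) *: v.
have wE : dotp w w = dotp v v * (dotp u u * dotp v v - dotp u v ^+ 2).
  by rewrite !(dotpDl, dotpDr, dotpZl, dotpZr) (dotpC v u); ring.
by have := dotp_ge0 w; rewrite wE pmulr_rge0// subr_ge0.
Qed.

Lemma dotp_le u v : `|dotp u v| <= enorm u * enorm v.
Proof.
rewrite -(@ler_pXn2r _ 2)// ?nnegrE ?mulr_ge0 ?enorm_ge0//.
by rewrite exprMn !enormE real_normK ?num_real// dotp_CauchySchwarz.
Qed.

Lemma enorm_add u v : enorm (u + v) <= enorm u + enorm v.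
Proof.
rewrite -(@ler_pXn2r _ 2)// ?nnegrE ?addr_ge0 ?enorm_ge0//.
rewrite sqrrD !enormE dotpDl !dotpDr (dotpC v u).
by have := le_trans (ler_norm _) (dotp_le u v); lra.
Qed.

Lemma mx_entry_le m p (A : 'M[R]_(m, p)) i j : `|A i j| <= `|A|.
Proof.
by rewrite [leRHS]mx_normrE; apply: (le_bigmax (0 : R) (fun k => `|A k.1 k.2|) (i, j)).
Qed.

(** Comparison with the max norm, in which continuity is expressed; the
    constant is not sharp. *)
Lemma enorm_le_norm u : enorm u <= n%:R * `|u|.
Proof.
rewrite -(@ler_pXn2r _ 2)// ?nnegrE ?mulr_ge0 ?enorm_ge0// enormE exprMn.
apply: (@le_trans _ _ (n%:R * `|u| ^+ 2)).
  rewrite mulr_natl -[X in _ *+ X]card_ord -sumr_const; apply: ler_sum => i _.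
  by rewrite -expr2 -real_normK ?num_real// lerXn2r ?nnegrE// mx_entry_le.
rewrite ler_wpM2r ?sqr_ge0// expr2 -natrM ler_nat.
by case: (n) => // k; rewrite leq_pmulr.
Qed.

(** Cauchy-Schwarz on each coordinate of the product; this shows that the
    supremum defining opnorm is taken over a bounded set. *)
Lemma enorm_mulmx_le_norm v A : enorm (v *m A) <= n%:R * `|A| * enorm v.
Proof.
rewrite -(@ler_pXn2r _ 2)// ?nnegrE ?mulr_ge0 ?enorm_ge0// enormE !exprMn enormE.
apply: (@le_trans _ _ (\sum_(j < n) dotp v v * (n%:R * `|A| ^+ 2))).
  apply: ler_sum => j _; rewrite -expr2.
  have -> : (v *m A) 0 j = dotp v (col j A)^T.
    by rewrite mxE; apply: eq_bigr => i _; rewrite !mxE.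
  apply: (le_trans (dotp_CauchySchwarz _ _)); rewrite ler_wpM2l ?dotp_ge0//.
  rewrite mulr_natl -[X in _ *+ X]card_ord -sumr_const; apply: ler_sum => i _.
  by rewrite !mxE -expr2 -real_normK ?num_real// lerXn2r ?nnegrE// mx_entry_le.
by rewrite sumr_const card_ord -mulr_natl le_eqVlt; apply/orP; left; apply/eqP; ring.
Qed.

Let opnorm_set A := [set enorm (v *m A) | v in [set v : 'rV[R]_n | enorm v <= 1]].

Let opnorm_ub A : ubound (opnorm_set A) (n%:R * `|A|).
Proof.
move=> _ [v /= v1 <-]; apply: (le_trans (enorm_mulmx_le_norm v A)).
by rewrite ler_piMr// mulr_ge0.
Qed.

Let opnorm_set0 A : opnorm_set A 0.
Proof. by exists 0; rewrite /= ?mul0mx enorm0. Qed.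

Lemma opnorm_ge0 A : 0 <= opnorm A.
Proof.
apply: (ub_le_sup _ (opnorm_set0 A)).
by exists (n%:R * `|A|); exact: opnorm_ub.
Qed.

Lemma opnorm_le_norm A : opnorm A <= n%:R * `|A|.
Proof. exact: (ge_sup (ex_intro _ 0 (opnorm_set0 A)) (@opnorm_ub A)). Qed.

Lemma enorm_mulmx v A : enorm (v *m A) <= opnorm A * enorm v.
Proof.
have [->|v0] := eqVneq v 0; first by rewrite mul0mx enorm0 mulr0.
have ev := enorm_gt0 v0.
rewrite -ler_pdivrMr// mulrC -[X in X * _]ger0_norm ?invr_ge0 ?enorm_ge0//.
rewrite -enormZ scalemxAl; apply: ub_le_sup.
  by exists (n%:R * `|A|); exact: opnorm_ub.
exists ((enorm v)^-1 *: v) => //=.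
by rewrite enormZ ger0_norm ?invr_ge0 ?enorm_ge0// mulVf// gt_eqF.
Qed.

Lemma opnorm_add A B : opnorm (A + B) <= opnorm A + opnorm B.
Proof.
apply: (ge_sup (ex_intro _ 0 (opnorm_set0 (A + B)))).
move=> _ [v /= v1 <-]; rewrite mulmxDr; apply: (le_trans (enorm_add _ _)).
apply: lerD; apply: (le_trans (enorm_mulmx _ _)); exact: ler_piMr (opnorm_ge0 _) _.
Qed.

Lemma opnormB A B : opnorm (A - B) = opnorm (B - A).
Proof.
by rewrite /opnorm; congr sup; apply/seteqP; split => _ [v /= v1 <-];
  exists (- v); rewrite /= ?mulNmx -?mulmxN ?opprB// -scaleN1r enormZ normrN1 mul1r.
Qed.

Lemma dotp_mulmx_le v A : `|dotp (v *m A) v| <= opnorm A * dotp v v.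
Proof.
apply: (le_trans (dotp_le _ _)); rewrite -enormE expr2 mulrA.
by rewrite ler_wpM2r ?enorm_ge0// enorm_mulmx.
Qed.

End Euclid.

(** * Rayleigh quotients of symmetric matrices *)

(** The first-order condition at a minimum: 2 t b + t ^ 2 q is negative for
    small t of sign opposite to b, and t = - b / (q + 1) is already small
    enough. *)
Lemma nonneg_quadratic_eq0 (R : realFieldType) (b q : R) : 0 <= q ->
  0 <= 2 * (- b / (q + 1)) * b + (- b / (q + 1)) ^+ 2 * q -> b = 0.
Proof.
move=> q0.
have -> : 2 * (- b / (q + 1)) * b + (- b / (q + 1)) ^+ 2 * q =
    - (b ^+ 2 * ((q + 2) / (q + 1) ^+ 2)) by field; lra.
rewrite oppr_ge0 => b0; apply/eqP; rewrite -sqrf_eq0 eq_le sqr_ge0 andbT.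
by move: b0; rewrite pmulr_lle0// divr_gt0 ?exprn_gt0//; lra.
Qed.

Section Rayleigh.
Context {R : realType} {n : nat}.
Implicit Types (u v w : 'rV[R]_n) (A : 'M[R]_n).

Lemma dotp_mulmx_sym A u v : A^T = A -> dotp (u *m A) v = dotp (v *m A) u.
Proof. by move=> sA; rewrite (dotpC (u *m A)) !dotpE trmx_mul sA mulmxA. Qed.

Lemma eigenvalue_dotp A a : eigenvalue A a ->
  exists2 v : 'rV[R]_n, v != 0 & dotp (v *m A) v = a * dotp v v.
Proof. by case/eigenvalueP => v vA v0; exists v => //; rewrite vA dotpZl. Qed.

Lemma quadratic_form_continuous A :
  continuous (fun v : 'rV[R]_n => dotp (v *m A) v).
Proof.
have -> : (fun v : 'rV[R]_n => dotp (v *m A) v) =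
    (fun v => \sum_(i < n) (\sum_(j < n) v 0 j * A j i) * v 0 i).
  by apply/funext => v; apply: eq_bigr => i _; rewrite mxE.
move=> v; apply: (cvg_big (@add_continuous _) (F := nbhs v)) => i _.
apply: cvgM; last exact: coord_continuous.
apply: (cvg_big (@add_continuous _) (F := nbhs v)) => j _.
by apply: cvgM; [exact: coord_continuous|exact: cvg_cst].
Qed.

Lemma unit_sphere_compact : compact [set v : 'rV[R]_n | dotp v v = 1].
Proof.
apply: bounded_closed_compact.
  exists 1; split => // M M1 v /= v1.
  rewrite [leLHS]mx_normrE; apply: bigmax_le => [|[i j] _ /=].
    exact/ltW/(lt_trans ltr01).
  apply: le_trans (ltW M1); rewrite -(@ler_pXn2r _ 2)// ?nnegrE//.
  rewrite real_normK ?num_real// expr1n -v1 /dotp (bigD1 j)//= ord1 expr2.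
  by rewrite lerDl sumr_ge0// => k _; rewrite -expr2 sqr_ge0.
apply: (@preimage_closed _ _ (fun v : 'rV[R]_n => dotp v v) [set x | x = 1]).
  move=> v _; have := @quadratic_form_continuous 1%:M v.
  by under [X in continuous_at _ X]eq_fun do rewrite mulmx1.
exact: closed_eq.
Qed.

(** The minimum a of the Rayleigh quotient is attained at some c on the
    compact unit sphere.  The form v (A - a) v^T is then nonnegative and
    vanishes at c, so that its derivative at c, in the direction
    w = c (A - a), vanishes too; this derivative is twice the squared length
    of w. *)
Lemma symmetric_min_eigenvalue A : (0 < n)%N -> A^T = A ->
  exists2 a, eigenvalue A a & forall v, a * dotp v v <= dotp (v *m A) v.
Proof.
move=> n_gt0 sA.
have S0 : [set v : 'rV[R]_n | dotp v v = 1] !=set0.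
  exists (delta_mx 0 (Ordinal n_gt0)); rewrite /= /dotp (bigD1 (Ordinal n_gt0))//=.
  rewrite big1 ?addr0 => [|i /negbTE i0].
    by rewrite mxE eqxx eqxx mulr1.
  by rewrite mxE eqxx i0 mulr0.
have [c] := compact_EVT_min S0 unit_sphere_compact
  (continuous_subspaceT (@quadratic_form_continuous A)).
rewrite inE /= => c1 cmin; set a := dotp (c *m A) c in cmin.
have q_ge0 v : a * dotp v v <= dotp (v *m A) v.
  have [->|v0] := eqVneq v 0; first by rewrite mul0mx /dotp !big1 ?mulr0// => i _;
    rewrite mxE mul0r.
  have vv := dotp_gt0 v0.
  have : a <= dotp (((enorm v)^-1 *: v) *m A) ((enorm v)^-1 *: v).
    apply: cmin; rewrite inE /= dotpZl dotpZr mulrA -expr2 exprVn enormE.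
    by rewrite mulVf// gt_eqF.
  rewrite -scalemxAl dotpZl dotpZr mulrA -expr2 exprVn enormE mulrC.
  by rewrite ler_pdivlMr.
exists a => //; apply/eigenvalueP; exists c; last first.
  apply/eqP => c0; move: c1; rewrite c0 /dotp big1 => [/eqP|i _].
    by rewrite eq_sym oner_eq0.
  by rewrite mxE mul0r.
(* The name w is kept opaque so that bilinearity does not unfold it. *)
have [w wE] : exists w, w = c *m A - a *: c by eexists.
apply/eqP; rewrite -subr_eq0 -wE; apply/eqP/dotp_eq0.
set Q := dotp (w *m A) w - a * dotp w w.
have Q0 : 0 <= Q by rewrite subr_ge0.
set b := dotp w w; set t := - b / (Q + 1).
have : 0 <= 2 * t * b + t ^+ 2 * Q.
  have := q_ge0 (c + t *: w); rewrite -subr_ge0 mulmxDl -scalemxAl.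
  rewrite !(dotpDl, dotpDr, dotpZl, dotpZr) (dotp_mulmx_sym w c sA) (dotpC w c).
  rewrite c1 -/a => /le_trans; apply; rewrite le_eqVlt; apply/orP; left; apply/eqP.
  have -> : b = dotp (c *m A) w - a * dotp c w.
    by rewrite /b {1}wE -scaleN1r dotpDl dotpZl dotpZl; ring.
  by rewrite /Q; ring.
exact: nonneg_quadratic_eq0.
Qed.

(** An infimum of an empty or unbounded set would be the junk value 0;
    symmetric_min_eigenvalue provides both the eigenvalue and the lower bound. *)
Lemma lambda_min_le A v : A^T = A -> lambda_min A * dotp v v <= dotp (v *m A) v.
Proof.
move=> sA; have [->|v0] := eqVneq v 0.
  by rewrite mul0mx /dotp !big1 ?mulr0// => i _; rewrite mxE mul0r.
have n_gt0 : (0 < n)%N.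
  rewrite lt0n; apply: contra v0 => /eqP n0; apply/eqP/rowP => -[i i_lt].
  by exfalso; rewrite n0 in i_lt.
have [a Aa amin] := symmetric_min_eigenvalue n_gt0 sA.
apply: le_trans (amin v); rewrite ler_wpM2r ?dotp_ge0//; apply: ge_inf => //.
exists a => b /eigenvalue_dotp[w w0 wb].
by have := amin w; rewrite wb ler_pM2r// dotp_gt0.
Qed.

End Rayleigh.

(** * Stable nonstationarity *)

(** Quotients and eigenvalues are eliminated in favour of inequalities that
    depend continuously on g and H, so that the predicate survives small
    perturbations, even towards a matrix H without real eigenvalues. *)
Definition nonstationary (R : realType) (n : nat) (e : R) (g : 'rV[R]_n)
    (H : 'M[R]_n) : Prop :=
  (e <= enorm g /\ e * opnorm H <= enorm g) \/
  exists2 v, v != 0 & dotp (v *m H) v <= - e * dotp v v.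

(** The perturbation of the bound e * |H| <= |g|.  The absolute error e / 2 is
    absorbed by e / 2 * h' when 1 <= h'; when h' <= 1 the bound e <= g is
    enough. *)
Lemma halved_lower_bounds (R : realFieldType) (e g g' dg h h' dh : R) : 0 < e ->
  e <= g -> e * h <= g -> dg + e * dh <= e / 2 -> g <= g' + dg ->
  h' <= h + dh -> 0 <= dh -> e / 2 <= g' /\ e / 2 * h' <= g'.
Proof.
move=> e0 eg ehg small g'g h'h dh0.
have edh : 0 <= e * dh by rewrite mulr_ge0// ltW.
have eh' : e * h' <= e * h + e * dh by rewrite -mulrDr ler_pM2l.
split; first lra.
have [h1|h1] := leP h' 1.
  by have : e * h' <= e * 1; [rewrite ler_pM2l|lra].
by have : e * 1 <= e * h'; [rewrite ler_pM2l// ltW|lra].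
Qed.

Section Nonstationary.
Context {R : realType} {n : nat}.
Implicit Types (g v : 'rV[R]_n) (H : 'M[R]_n) (e : R).

Lemma min_ratio_ge c (a : R) b e : 0 <= b -> e <= c -> e * b <= a ->
  e <= min_ratio c a b.
Proof.
rewrite /min_ratio; case: eqVneq => // b0 b_ge0 ec eb.
by rewrite le_min ec ler_pdivlMr// lt_def b0.
Qed.

Lemma min_ratio_geE c (a : R) b e : 0 <= a -> 0 <= b -> e <= min_ratio c a b ->
  e <= c /\ e * b <= a.
Proof.
move=> a0; rewrite /min_ratio; case: eqVneq => [->|b0 b_ge0].
  by rewrite mulr0.
by rewrite le_min => /andP[-> ]; rewrite ler_pdivlMr// lt_def b0.
Qed.

Lemma stat_measure_ge0 g H : 0 <= stat_measure g H.
Proof.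
by rewrite /stat_measure le_max min_ratio_ge ?mul0r ?enorm_ge0 ?opnorm_ge0.
Qed.

(** H need not be symmetric, but a negative value
    of lambda_min forces the set of real eigenvalues to be nonempty, and an
    eigenvector gives a direction of negative curvature.  The infimum need not
    be attained, hence the loss from e to e'. *)
Lemma nonstationary_of_stat_measure g H e e' : 0 <= e' -> e' < e ->
  e <= stat_measure g H -> nonstationary e' g H.
Proof.
move=> e'0 e'e; have e0 := le_lt_trans e'0 e'e.
rewrite /stat_measure le_max => /orP[|].
  move=> /min_ratio_geE[||ge gH]; [exact: enorm_ge0|exact: opnorm_ge0|left].
  split; first exact: (le_trans (ltW e'e)).
  by apply: le_trans gH; rewrite ler_wpM2r ?opnorm_ge0// ltW.
rewrite lerNr => lamH; right.
have [[a /eigenvalue_dotp[v v0 va] ae]|nex] :=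
  pselect (exists2 a, eigenvalue H a & a <= - e').
  by exists v => //; rewrite va ler_wpM2r ?dotp_ge0.
exfalso; have : - e' <= lambda_min H.
  apply: lb_le_inf.
    apply/set0P/eqP => E0; move: lamH.
    by rewrite /lambda_min E0 inf0 leNgt oppr_lt0 e0.
  by move=> a Ha; rewrite leNgt; apply/negP => /ltW ae; apply: nex; exists a.
by move=> /le_trans/(_ lamH); rewrite lerN2 leNgt e'e.
Qed.

(** A converse without loss, by the Rayleigh bound; this is where the
    symmetry of the model Hessian enters. *)
Lemma stat_measure_of_nonstationary g H e : H^T = H -> nonstationary e g H ->
  e <= stat_measure g H.
Proof.
move=> sH; rewrite /stat_measure le_max => -[[ge gH]|[v v0 vH]].
  by rewrite min_ratio_ge ?opnorm_ge0.
apply/orP; right; rewrite lerNr -(ler_pM2r (dotp_gt0 v0)).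
exact: le_trans (lambda_min_le _ sH) vH.
Qed.

(** Stability in both regimes: large gradient, or direction of negative
    curvature.  No bound on the norms of H and H' is involved, which is what
    allows models with unbounded Hessians. *)
Lemma nonstationary_perturb g g' H H' e : 0 < e ->
  enorm (g - g') + e * opnorm (H - H') <= e / 2 -> opnorm (H - H') <= e / 2 ->
  nonstationary e g H -> nonstationary (e / 2) g' H'.
Proof.
move=> e0 gH He [[ge gHe]|[v v0 vH]].
  left; apply: (halved_lower_bounds e0 ge gHe gH _ _ (opnorm_ge0 _)).
    by have := enorm_add g' (g - g'); rewrite addrC subrK.
  by rewrite (opnormB H); have := opnorm_add H (H' - H); rewrite addrC subrK.
right; exists v => //.
have -> : H' = H - (H - H') by rewrite opprB addrC subrK.
rewrite mulmxBr -scaleN1r dotpDl dotpZl mulN1r.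
have := dotp_mulmx_le v (H - H'); rewrite ler_norml => /andP[+ _]; rewrite lerNl => dvH.
apply: le_trans (lerD vH (le_trans dvH (ler_wpM2r (dotp_ge0 v) He))) _.
by rewrite -mulrDl ler_wpM2r ?dotp_ge0//; clear -e0; lra.
Qed.

Lemma near_nonstationary (T : topologicalType) (x : T) (g : T -> 'rV[R]_n)
    (H : T -> 'M[R]_n) e :
  0 < e -> {for x, continuous g} -> {for x, continuous H} ->
  nonstationary e (g x) (H x) -> \forall y \near x, nonstationary (e / 2) (g y) (H y).
Proof.
move=> e0 gx Hx nsx.
have N0 : (0 : R) < n.+1%:R by rewrite ltr0Sn.
have smallN (x' N r : R) : 0 <= N -> x' <= n%:R * N -> N <= r / n.+1%:R -> x' <= r.
  move=> N_ge0 xN; rewrite ler_pdivlMr// mulrC => /(le_trans _); apply.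
  by apply: le_trans xN _; rewrite ler_wpM2r// ler_nat.
near=> y.
have gy : enorm (g x - g y) <= e / 4.
  apply: (smallN _ _ _ (normr_ge0 _) (enorm_le_norm _)).
  near: y; apply: cvgr_dist_le gx _ _; by rewrite !divr_gt0.
have Hy r : r = e / 2 \/ r = 4^-1 -> opnorm (H x - H y) <= r.
  move=> rE; apply: (smallN _ _ _ (normr_ge0 _) (opnorm_le_norm _)).
  case: rE => ->; near: y; apply: cvgr_dist_le Hx _ _; by rewrite !divr_gt0.
apply: (nonstationary_perturb e0 _ _ nsx); last by apply: Hy; left.
have : e * opnorm (H x - H y) <= e * 4^-1 by rewrite ler_pM2l// Hy//; right.
move/(lerD gy)/le_trans; apply; clear; lra.
Unshelve. all: by end_near. Qed.

End Nonstationary.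

(** * Acceptance of a single step *)

(** With errors at most k in both values, the actual decrease differs from the
    predicted one by at most 2 k, a fraction 1 - eta of it. *)
Lemma ratio_ge (R : realFieldType) (eta D k a b ma mb : R) :
  0 < D -> D <= ma - mb -> `|a - ma| <= k -> `|b - mb| <= k ->
  2 * k <= (1 - eta) * D -> eta < 1 -> eta <= (a - b) / (ma - mb).
Proof.
move=> D0 Dm; rewrite !ler_norml => /andP[ak _] /andP[_ bk] kD eta1.
have m0 := lt_le_trans D0 Dm.
have : (1 - eta) * D <= (1 - eta) * (ma - mb) by rewrite ler_wpM2l//; lra.
by rewrite ler_pdivlMr//; lra.
Qed.

Section Step.
Context {R : realType} {n : nat}.
Context (f : 'rV[R]_n -> R) (eta1 eta2 kfod : R).
Implicit Types (m : qmodel R n) (x s : 'rV[R]_n) (delta : R).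

(** The powers of delta that the whole argument rests on: for small delta, with e
    proportional to delta the bound has order delta ^ 3, and with e fixed it has
    order delta ^ 2, which beats the error kef * delta ^ 3 of a fully quadratic
    model. *)
Lemma fod_decrease_ge m x s delta e : 0 <= kfod -> 0 <= e -> 0 <= delta ->
  frac_optimal_decrease kfod m x delta s -> e <= tau_model m ->
  kfod / 2 * (e * Num.min (Num.min e delta) (delta ^+ 2)) <=
  model_fun m x x - model_fun m x (x + s).
Proof.
move=> k0 e0 d0 fod em; apply: le_trans fod.
apply: ler_wpM2l; first by rewrite divr_ge0.
move: em; rewrite /tau_model /stat_measure !le_max => /orP[|lam].
  move=> /min_ratio_geE[||ge gH]; rewrite ?enorm_ge0 ?opnorm_ge0//.
  apply/orP; left; apply: ler_pM => //; first by rewrite !le_min e0 d0 sqr_ge0.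
  apply: (@le_trans _ _ (Num.min e delta)); first by rewrite ge_min lexx.
  apply: min_ratio_ge; rewrite ?opnorm_ge0//; first by rewrite ge_min lexx orbT.
  by apply: le_trans gH; rewrite ler_wpM2r ?opnorm_ge0// ge_min lexx.
apply/orP; right; apply: ler_pM => //.
- by rewrite !le_min e0 d0 sqr_ge0.
- by rewrite le_max lam.
- by rewrite ge_min lexx orbT.
Qed.

(** Acceptance provides e = eta2 * delta in fod_decrease_ge.  A vanishing
    predicted decrease is excluded since the ratio would be 0 < eta1. *)
Lemma tr_accept_decrease m x s delta : 0 < eta1 -> 0 < eta2 -> 0 <= kfod ->
  0 <= delta ->
  frac_optimal_decrease kfod m x delta s -> tr_accept eta1 eta2 f m x delta s ->
  eta1 * (kfod / 2 * (eta2 * delta *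
    Num.min (Num.min (eta2 * delta) delta) (delta ^+ 2))) <= f x - f (x + s).
Proof.
move=> eta10 eta20 k0 d0 fod /andP[rho tm].
have e0 : 0 <= eta2 * delta by rewrite mulr_ge0// ltW.
have := fod_decrease_ge k0 e0 d0 fod tm; set D := kfod / 2 * _ => DM.
have D0 : 0 <= D.
  apply: mulr_ge0; first by rewrite divr_ge0.
  by apply: mulr_ge0; rewrite // !le_min e0 d0 sqr_ge0.
have M0 : 0 < model_fun m x x - model_fun m x (x + s).
  rewrite lt_def (le_trans D0 DM) andbT; apply/eqP => M0.
  by move: rho; rewrite /tr_ratio M0 invr0 mulr0 leNgt eta10.
move: rho; rewrite /tr_ratio ler_pdivlMr//; apply: le_trans.
by rewrite ler_pM2l.
Qed.

(** Nonstationarity passes from f to the model, so the predicted decrease is at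
    least of order e * delta ^ 2, whereas prediction errors are of order
    delta ^ 3. *)
Lemma tr_accept_of_fully_quadratic keh keg kef m x s delta e :
  eta1 < 1 -> 0 < kfod -> 0 < e -> 0 < delta ->
  nonstationary e (gradient f x) (hessian f x) ->
  fully_quadratic keh keg kef f m x delta ->
  frac_optimal_decrease kfod m x delta s -> eball 0 delta s ->
  [/\ delta <= 1, delta <= e / 2 & eta2 * delta <= e / 2] ->
  [/\ keh * delta <= e / 2, keg * delta ^+ 2 + e * (keh * delta) <= e / 2
     & 2 * (kef * delta ^+ 3) <= (1 - eta1) * (kfod / 2 * (e / 2 * delta ^+ 2))] ->
  tr_accept eta1 eta2 f m x delta s.
Proof.
move=> eta1_lt1 k0 e0 d0 ns fq fod ss [d1 de d_eta] [hd gd fd].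
have b0 : eball 0 delta (0 : 'rV[R]_n) by rewrite /eball /= subr0 enorm0 ltW.
have [h0 g0 f0] := fq 0 b0; have [_ _ fs] := fq s ss.
rewrite gradient_model_fun addr0 subrr mul0mx addr0 in h0 g0 f0.
have tm : e / 2 <= tau_model m.
  apply: stat_measure_of_nonstationary; first exact: mhess_sym.
  apply: (nonstationary_perturb e0 _ _ ns); last exact: le_trans h0 hd.
  by apply: le_trans gd; rewrite lerD// ler_pM2l.
have e20 : 0 <= e / 2 by rewrite divr_ge0// ltW.
have := fod_decrease_ge (ltW k0) e20 (ltW d0) fod tm.
have -> : Num.min (Num.min (e / 2) delta) (delta ^+ 2) = delta ^+ 2.
  rewrite (min_idPr de); apply/min_idPr.
  by rewrite expr2 ler_piMl// ltW.
move=> DM; rewrite /tr_accept (le_trans d_eta tm) andbT.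
apply: (ratio_ge _ DM f0 fs fd eta1_lt1).
by rewrite !mulr_gt0 ?invr_gt0 ?exprn_gt0.
Qed.

Lemma near0_linear_le (a b : R) : 0 < b -> \forall d \near 0^'+, a * d <= b.
Proof.
move=> b0; have a1 : 0 < `|a| + 1 by rewrite ltr_wpDl.
near=> d; have d0 : 0 < d by near: d; exact: nbhs_right_gt.
apply: (@le_trans _ _ ((`|a| + 1) * d)).
  by rewrite ler_pM2r// (le_trans (ler_norm a))// lerDl.
rewrite mulrC -ler_pdivlMr//; near: d; apply: nbhs_right_le.
by rewrite divr_gt0.
Unshelve. all: by end_near. Qed.

(** The threshold on delta is uniform in the point, the model and the step:
    it depends on the constants and on e alone. *)
Lemma near0_tr_accept keh keg kef e : eta1 < 1 -> 0 < kfod -> 0 < e ->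
  \forall delta \near 0^'+, forall m x s,
    nonstationary e (gradient f x) (hessian f x) ->
    fully_quadratic keh keg kef f m x delta ->
    frac_optimal_decrease kfod m x delta s -> eball 0 delta s ->
    tr_accept eta1 eta2 f m x delta s.
Proof.
move=> eta1_lt1 k0 e0; have e20 : 0 < e / 2 by rewrite divr_gt0.
have D0 : 0 < (1 - eta1) * (kfod / 2 * (e / 2)).
  by rewrite !mulr_gt0 ?subr_gt0 ?invr_gt0.
near=> delta => m x s ns fq fod ss.
have d0 : 0 < delta by near: delta; exact: nbhs_right_gt.
have d1 : delta <= 1 by near: delta; exact: nbhs_right_le.
apply: (tr_accept_of_fully_quadratic eta1_lt1 k0 e0 d0 ns fq fod ss).
  split=> //; first by near: delta; exact: nbhs_right_le.
  by near: delta; exact: near0_linear_le.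
split; first by near: delta; exact: near0_linear_le.
  apply: (@le_trans _ _ ((`|keg| + e * keh) * delta)).
    rewrite mulrDl -(mulrA e) lerD2r expr2 mulrA ler_wpM2r ?(ltW d0)//.
    apply: le_trans (_ : `|keg| * delta <= _); last by rewrite ler_piMr.
    by rewrite ler_wpM2r ?ler_norm ?(ltW d0).
  by near: delta; exact: near0_linear_le.
have -> : 2 * (kef * delta ^+ 3) = 2 * kef * delta * delta ^+ 2 by ring.
rewrite (mulrA (kfod / 2)) (mulrA (1 - eta1)) ler_wpM2r ?sqr_ge0//.
by near: delta; exact: near0_linear_le.
Unshelve. all: by end_near. Qed.

End Step.

(** * The radii of a run tend to zero *)

Section Run.
Context {R : realType}.

(** The Lyapunov function is F k + nu * d k ^ 3.  The choice of nu makes an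
    increase of nu * d k ^ 3 on a step of the first kind cost at most half of
    the decrease of F; on a step of the second kind the term itself contracts
    by the factor gamma ^ -3. *)
Lemma sufficient_decrease_cvg0 (F d : nat -> R) (gamma c b : R) :
  1 < gamma -> 0 < c -> (forall k, 0 < d k) -> (forall k, b <= F k) ->
  (forall k, (F k.+1 <= F k - c * d k ^+ 3 /\ d k.+1 <= gamma * d k) \/
             (F k.+1 <= F k /\ d k.+1 = gamma^-1 * d k)) ->
  d @ \oo --> 0.
Proof.
move=> g1 c0 d0 Fb step; have g0 : 0 < gamma by exact: lt_trans g1.
have g3 : 0 < gamma ^+ 3 by rewrite exprn_gt0.
pose nu := c / (2 * gamma ^+ 3); pose q := gamma^-1 ^+ 3.
have nu0 : 0 < nu by rewrite divr_gt0// mulr_gt0.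
have q1 : q < 1 by rewrite exprn_ilt1 ?invr_ge0 ?(ltW g0)// invf_lt1.
pose Phi k := F k + nu * d k ^+ 3; pose c' := Num.min (c / 2) (nu * (1 - q)).
have c'0 : 0 < c' by rewrite lt_min divr_gt0//= mulr_gt0// subr_gt0.
have dec k : c' * d k ^+ 3 <= Phi k - Phi k.+1.
  have dk3 : 0 < d k ^+ 3 by rewrite exprn_gt0.
  rewrite /Phi; case: (step k) => [[Fk dk]|[Fk ->]].
    apply: (@le_trans _ _ (c / 2 * d k ^+ 3)); first by rewrite ler_pM2r// ge_min lexx.
    have : nu * d k.+1 ^+ 3 <= c / 2 * d k ^+ 3.
      have -> : c / 2 * d k ^+ 3 = nu * (gamma * d k) ^+ 3.
        by rewrite /nu exprMn; field; rewrite gt_eqF.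
      by rewrite ler_pM2l// lerXn2r ?nnegrE ?mulr_ge0 ?(ltW g0) ?(ltW (d0 _)).
    have : 0 <= nu * d k ^+ 3 by rewrite mulr_ge0 ?ltW.
    by move: Fk; clear; lra.
  apply: (@le_trans _ _ (nu * (1 - q) * d k ^+ 3)).
    by rewrite ler_pM2r// ge_min lexx orbT.
  by rewrite exprMn -/q; move: Fk; clear; lra.
have cvPhi : cvgn Phi.
  apply: nonincreasing_is_cvgn.
    apply/nonincreasing_seqP => k; rewrite -subr_ge0; apply: le_trans (dec k).
    by rewrite mulr_ge0 ?exprn_ge0 ?ltW.
  exists b => _ [k _ <-]; apply: le_trans (Fb k) _.
  by rewrite lerDl mulr_ge0 ?exprn_ge0 ?ltW.
have dPhi : (fun k => Phi k - Phi k.+1) @ \oo --> 0.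
  rewrite -(subrr (limn Phi)); apply: cvgB => //.
  by rewrite (cvg_shiftS Phi).
apply/cvgr0Pnorm_lt => e e0.
have /cvgr0Pnorm_lt/(_ (c' * e ^+ 3)) near := dPhi.
near=> k; rewrite gtr0_norm// -(@ltr_pXn2r _ 3)// ?nnegrE ?ltW//.
rewrite -(ltr_pM2l c'0); apply: le_lt_trans (dec k) _.
apply: le_lt_trans (ler_norm _) _.
by near: k; apply: near; rewrite mulr_gt0// exprn_gt0.
Unshelve. all: by end_near. Qed.

Context {n : nat} (f : 'rV[R]_n -> R) (x0 : 'rV[R]_n).
Context (eta1 eta2 gamma dmax kfod delta0 : R).
Context (x : nat -> 'rV[R]_n) (delta : nat -> R) (m : nat -> qmodel R n)
  (s : nat -> 'rV[R]_n).
Context (eta1_gt0 : 0 < eta1) (eta2_gt0 : 0 < eta2) (gamma_gt1 : 1 < gamma)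
  (kfod_gt0 : 0 < kfod) (delta0_gt0 : 0 < delta0) (delta0_le : delta0 <= dmax).
Context (run : tr_run eta1 eta2 gamma dmax kfod f x0 delta0 x delta m s).

Let gamma_gt0 : 0 < gamma. Proof. exact: lt_trans gamma_gt1. Qed.
Let dmax_gt0 : 0 < dmax. Proof. exact: lt_le_trans delta0_le. Qed.

Let gammaV_le1 : gamma^-1 <= 1. Proof. by rewrite invf_le1 ?ltW. Qed.

Lemma radius_range k : 0 < delta k <= dmax.
Proof.
case: run => _ d0 step; elim: k => [|k /andP[dk dkm]]; first by rewrite d0 delta0_gt0.
case: (step k) => _ _ _ ->; case: ifP => _; apply/andP; split.
- by rewrite lt_min dmax_gt0 andbT mulr_gt0.
- by rewrite ge_min lexx orbT.
- by rewrite mulr_gt0 ?invr_gt0.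
- by apply: le_trans dkm; rewrite ler_piMl// ltW.
Qed.

Lemma radius_gt0 k : 0 < delta k. Proof. by case/andP: (radius_range k). Qed.

Lemma radius_le k : delta k <= dmax. Proof. by case/andP: (radius_range k). Qed.

(** Even an accepted step obeys this bound when the cap dmax applies, since
    the radius was at most dmax before. *)
Lemma radius_ge_step k : gamma^-1 * delta k <= delta k.+1.
Proof.
have dk : gamma^-1 * delta k <= delta k by rewrite ler_piMl ?(ltW (radius_gt0 k)).
case: run => _ _ /(_ k)[_ _ _ ->]; case: ifP => // _.
rewrite le_min (le_trans dk (radius_le k)) andbT (le_trans dk)//.
by rewrite ler_peMl ?(ltW (radius_gt0 k))// ltW.
Qed.

Lemma radius_lower k : delta0 * gamma^-1 ^+ k <= delta k.
Proof.
elim: k => [|k IH]; first by case: run => _ -> _; rewrite expr0 mulr1.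
apply: le_trans (radius_ge_step k).
by rewrite exprSr mulrA mulrC ler_pM2l// invr_gt0.
Qed.

Lemma radius_le_step k : delta k.+1 <= gamma * delta k.
Proof.
case: run => _ _ /(_ k)[_ _ _ ->]; case: ifP => _; first by rewrite ge_min lexx.
rewrite ler_pM2r ?radius_gt0//.
by rewrite (@le_trans _ _ 1)// ?invf_le1// ltW.
Qed.

Let c := eta1 * (kfod / 2 * (eta2 *
  Num.min (Num.min (eta2 / dmax) dmax^-1) 1)).

(** The constant comes from e = eta2 * delta_k together with
    delta_k <= dmax, which bounds delta_k ^ 2 below by delta_k ^ 3 / dmax. *)
Lemma run_decrease k : tr_accept eta1 eta2 f (m k) (x k) (delta k) (s k) ->
  c * delta k ^+ 3 <= f (x k) - f (x k.+1).
Proof.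
case: run => _ _ /(_ k)[sk fod -> _] acc; rewrite acc.
have dk := radius_gt0 k.
apply: le_trans (tr_accept_decrease eta1_gt0 eta2_gt0 (ltW kfod_gt0) (ltW dk) fod acc).
rewrite /c -!mulrA ler_pM2l// ler_pM2l// ler_pM2l ?invr_gt0// ler_pM2l//.
rewrite (exprS _ 2) mulrCA ler_pM2l//.
have dd : dmax^-1 * delta k <= 1 by rewrite mulrC ler_pdivrMr// mul1r radius_le.
have d2 : dmax^-1 * delta k ^+ 2 <= delta k.
  by rewrite expr2 mulrA -[leRHS]mul1r ler_pM2r.
have d20 := sqr_ge0 (delta k).
rewrite !le_min; apply/andP; split; last by rewrite ler_piMl// ge_min lexx orbT.
apply/andP; split.
  apply: (@le_trans _ _ (eta2 / dmax * delta k ^+ 2)).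
    by rewrite ler_wpM2r// !ge_min lexx.
  by rewrite -mulrA ler_pM2l.
by apply: le_trans d2; rewrite ler_wpM2r// !ge_min lexx orbT.
Qed.

Let c_gt0 : 0 < c.
Proof.
by rewrite /c !mulr_gt0 ?invr_gt0// !lt_min ltr01 divr_gt0//= invr_gt0 dmax_gt0.
Qed.

Lemma run_nonincreasing k : f (x k.+1) <= f (x k).
Proof.
have [acc|/negbTE acc] := boolP (tr_accept eta1 eta2 f (m k) (x k) (delta k) (s k)).
  rewrite -subr_ge0; apply: le_trans (run_decrease acc).
  by rewrite mulr_ge0 ?exprn_ge0 ?ltW ?radius_gt0.
by case: run => _ _ /(_ k)[_ _ -> _]; rewrite acc.
Qed.

Lemma run_levelset k : levelset f x0 (x k).
Proof.
elim: k => [|k IH]; first by case: run => -> _ _; rewrite /levelset /=.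
exact: le_trans (run_nonincreasing k) IH.
Qed.

Lemma radius_cvg0 b : (forall y, levelset f x0 y -> b <= f y) -> delta @ \oo --> 0.
Proof.
move=> fb; apply: (@sufficient_decrease_cvg0 (f \o x) delta gamma c b) => //.
- exact: radius_gt0.
- by move=> k; exact/fb/run_levelset.
- move=> k.
  have [acc|/negbTE acc] := boolP (tr_accept eta1 eta2 f (m k) (x k) (delta k) (s k)).
    left; split; last exact: radius_le_step.
    by have := run_decrease acc; rewrite /= lerBrDl lerBrDr addrC.
  right; split; first exact: run_nonincreasing.
  by case: run => _ _ /(_ k)[_ _ _ ->]; rewrite acc.
Qed.

End Run.

(** * A nonnegative process with likely decrease cannot escape *)

Section Escape.
Context {R : realType} {d : measure_display} {T : measurableType d}.
Context (P : probability T R) (L b : R) (V : nat -> T -> R).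
Context (C S : nat -> set T).
Context (L_gt0 : 0 < L) (mV : forall k, measurable_fun setT (V k))
  (V_ge0 : forall k w, 0 <= V k w) (V0_le : forall w, V 0 w <= b)
  (mC : forall k, measurable (C k)) (C_dec : forall k, C k.+1 `<=` C k)
  (mS : forall k, measurable (S k))
  (S_likely : forall k, (P (C k) <= 2%:E * P (S k `&` C k))%E)
  (V_step : forall k w, C k w -> V k.+1 w + 2 * L * \1_(S k) w <= V k w + L).

Let mVE k D : measurable D -> measurable_fun D (EFin \o V k).
Proof.
move=> mD; apply/measurable_EFinP; exact: measurable_funS (mV k).
Qed.

Let a k := (\int[P]_(w in C k) (V k w)%:E)%E.

(** Adding 2 L 1_S to V k.+1 and L to V k keeps all integrands nonnegative; the
    added terms contribute 2 L P(S k, C k) and L P(C k), and the first is the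
    larger. *)
Let a_dec k : (a k.+1 <= a k)%E.
Proof.
apply: (@le_trans _ _ (\int[P]_(w in C k) (V k.+1 w)%:E)%E).
  apply: ge0_subset_integral => //; first exact: mVE.
  by move=> w _; rewrite lee_fin.
have mind : measurable_fun (C k) (fun w => (\1_(S k) w : R)%:E).
  exact/measurable_EFinP/measurable_indic.
have L20 : 0 <= 2 * L by rewrite mulr_ge0// ltW.
have : (\int[P]_(w in C k) ((V k.+1 w)%:E + (2 * L)%:E * (\1_(S k) w)%:E) <=
        \int[P]_(w in C k) ((V k w)%:E + L%:E))%E.
  apply: ge0_le_integral => //.
  - by move=> w _; rewrite -EFinM -EFinD lee_fin addr_ge0// mulr_ge0.
  - by apply: emeasurable_funD; [exact: mVE|exact: measurable_funeM].
  - by apply: emeasurable_funD; [exact: mVE|exact: measurable_cst].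
  - by move=> w Cw; rewrite -EFinM -!EFinD lee_fin V_step.
rewrite (ge0_integralD P (mC k)); last first.
- exact: measurable_funeM.
- by move=> w _; rewrite -EFinM lee_fin mulr_ge0.
- exact: mVE.
- by move=> w _; rewrite lee_fin.
rewrite (ge0_integralD P (mC k)); last first.
- exact: measurable_cst.
- by move=> w _; rewrite lee_fin ltW.
- exact: mVE.
- by move=> w _; rewrite lee_fin.
rewrite ge0_integralZl_EFin// integral_indic// integral_cst// => step.
rewrite -(@leeD2rE _ ((2 * L)%:E * P (S k `&` C k))%E); last first.
  by rewrite fin_numM// fin_num_measure//; exact: measurableI.
apply: le_trans step _; rewrite leeD2l// (mulrC 2) EFinM -muleA.
by rewrite lee_pmul2l ?lte_fin//; exact: S_likely.
Qed.

Let a_le k : (a k <= b%:E)%E.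
Proof.
elim: k => [|k IH]; last exact: le_trans (a_dec k) IH.
have b_ge0 : 0 <= b by apply: le_trans (V0_le point); exact: V_ge0.
apply: (@le_trans _ _ (\int[P]_(w in C 0) (cst b%:E w))%E).
  apply: ge0_le_integral => //.
  - by move=> w _; rewrite lee_fin.
  - exact: mVE.
  - by move=> w _; rewrite lee_fin.
rewrite integral_cst// -[leRHS]mule1 lee_pmul//; exact: probability_le1.
Qed.

(** The expectations of V k on C k are bounded by b (a_le), hence so are those
    on E; by Fatou's lemma the expectation on E of the limit +oo is at most b,
    which forces E to be null. *)
Lemma supermartingale_escape E : measurable E -> (forall k, E `<=` C k) ->
  (forall w, E w -> V ^~ w @ \oo --> +oo) -> P E = 0%E.
Proof.
move=> mE EC Ey.
have Ea k : (\int[P]_(w in E) (V k w)%:E <= b%:E)%E.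
  apply: le_trans (a_le k); apply: ge0_subset_integral => //; first exact: mVE.
  by move=> w _; rewrite lee_fin.
have := fatou P mE (fun k => mVE k mE) (fun k w _ => V_ge0 k w : (0 <= (V k w)%:E)%E).
rewrite (@eq_integral _ _ _ P E (cst +oo%E)); last first.
  move=> w /set_mem Ew; rewrite (cvg_limn_einf_sup (l := +oo%E))//.
  by apply/cvgeryP; exact: Ey.
rewrite integral_cst// => lefatou.
have : (+oo * P E <= b%:E)%E.
  apply: le_trans lefatou _; rewrite limn_einf_lim.
  apply: lime_le; first exact: is_cvg_einfs.
  apply: nearW => k; apply: le_trans (Ea k); apply: ereal_inf_lbound.
  by exists k => //=.
have := measure_ge0 P E; rewrite le_eqVlt => /orP[/eqP <-//|PE0].
by rewrite gt0_mulye// leNgt ltry.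
Qed.

End Escape.

(** * Events of the past *)

Section Filtration.
Context {R : realType} {n : nat} {d : measure_display} {T : measurableType d}.

(** Only the coordinates of X are known to be measurable; an open set is the
    countable union of the boxes with rational centre and radius 1 / (r + 1)
    that it contains. *)
Lemma open_preimage_wrt (G : set (set T)) (X : T -> 'rV[R]_n) (O : set 'rV[R]_n) :
  (forall i, measurable_wrt G (fun w => X w 0 i)) -> open O -> <<s G >> (X @^-1` O).
Proof.
move=> mX oO.
pose box (q : 'rV[rat]_n * nat) : set 'rV[R]_n :=
  [set y | forall i, y 0 i \in
     `]ratr (q.1 0 i) - q.2.+1%:R^-1, ratr (q.1 0 i) + q.2.+1%:R^-1[].
have OE : O = \bigcup_q (box q `&` [set _ | box q `<=` O]).
  apply/seteqP; split => [x Ox|x [q _ [/= xq]]]; last by apply.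
  have /nbhs_ballP[e /= e0 xeO] : nbhs x O by exact: open_nbhs_nbhs.
  have e20 : 0 < e / 2 by rewrite divr_gt0.
  (* A box of radius r around a rational point r-close to x lies in the ball of
     radius 2 r around x. *)
  have [k _ /(_ k (leqnn k)) ke] := near_infty_natSinv_lt (PosNum e20).
  have {}ke : k.+1%:R^-1 < e / 2 by [].
  have qex i : exists q : rat, ratr q \in `]x 0 i - k.+1%:R^-1, x 0 i + k.+1%:R^-1[.
    by apply: rat_in_itvoo; rewrite ltrD2l gtrN// invr_gt0.
  have [q xq] := choice qex.
  exists (\row_i q i, k) => //; split=> [i /=|y /= yq].
    by have := xq i; rewrite mxE !in_itv /= ltrBlDr andbC ltrBlDr andbC.
  apply: xeO; split=> // i j; rewrite ord1 /ball /= ltr_norml.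
  have := xq j; have := yq j; rewrite !in_itv /= mxE.
  move=> /andP[y1 y2] /andP[x1 x2]; apply/andP; split.
    by move: ke x1 x2 y1 y2; move: (k.+1%:R^-1) (x 0 j) (y 0 j) (ratr _) => r a c q0; clear; lra.
  by move: ke x1 x2 y1 y2; move: (k.+1%:R^-1) (x 0 j) (y 0 j) (ratr _) => r a c q0; clear; lra.
rewrite OE preimage_bigcup.
apply: (@countable_bigcupT_measurable _ (g_sigma_algebraType G)).
  exact: countableP.
move=> q; have [qO|qO] := pselect (box q `<=` O); last first.
  rewrite (_ : _ @^-1` _ = set0); first exact: measurable0.
  by apply/seteqP; split => // w [].
rewrite (_ : _ @^-1` _ = \bigcap_i ((fun w => X w 0 i) @^-1`
    `]ratr (q.1 0 i) - q.2.+1%:R^-1, ratr (q.1 0 i) + q.2.+1%:R^-1[%classic)).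
  apply: (@fin_bigcap_measurable _ (g_sigma_algebraType G)) => // i _.
  rewrite -[_ @^-1` _]setTI.
  by apply: (mX i) => //.
apply/seteqP; split => [w [xw _] i _|w xw]; first exact: (xw i).
by split => // i; exact: (xw i Logic.I).
Qed.

(** The bound p <= Z holds almost everywhere, so Z may be replaced by
    max(Z, p) under the integral, which is at least p everywhere. *)
Lemma cond_prob_ge_le (P : probability T R) (G : set (set T)) (E A : set T) (p : R) :
  0 <= p -> <<s G >> `<=` measurable -> cond_prob_ge P G E p -> <<s G >> A ->
  (p%:E * P A <= P (E `&` A))%E.
Proof.
move=> p0 subG [Z [mE _ iZ ZE] pZ] GA; have mA := subG _ GA.
have mZ : measurable_fun setT Z by exact/measurable_EFinP/(measurable_int P).
have mZA : measurable_fun A Z by exact: measurable_funS mZ.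
have mmax : measurable_fun A (fun w => Num.max (Z w) p).
  by apply: measurable_maxr => //; exact: measurable_cst.
have <- : (\int[P]_(w in A) (Num.max (Z w) p)%:E = P (E `&` A))%E.
  rewrite -ZE//; apply: ae_eq_integral => //; try exact/measurable_EFinP.
  by apply: filterS pZ => w pw _; rewrite (max_idPl pw).
rewrite -integral_cst//; apply: ge0_le_integral => //; first exact/measurable_EFinP.
by move=> w _; rewrite lee_fin le_max lexx orbT.
Qed.

Lemma past_events_measurable (M : nat -> T -> qmodel R n) k :
  (forall j, random_model (M j)) -> <<s past_events M k >> `<=` measurable.
Proof.
move=> mM; apply: smallest_sub; first exact: sigma_algebra_measurable.
move=> _ [j [c [B [_ mc mB ->]]]]; rewrite -[_ @^-1` _]setTI.
exact: mM.
Qed.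

Lemma past_events_le (M : nat -> T -> qmodel R n) j k : (j <= k)%N ->
  <<s past_events M j >> `<=` <<s past_events M k >>.
Proof.
move=> jk; apply: sub_sigma_algebra2 => A [i [c [B [ij mc mB ->]]]].
by exists i, c, B; split => //; exact: leq_trans jk.
Qed.

Lemma measurable_wrt_fun (G : set (set T)) (Z : T -> R) :
  <<s G >> `<=` measurable -> measurable_wrt G Z -> measurable_fun setT Z.
Proof. by move=> subG mZ _ B mB; apply: subG; exact: mZ. Qed.

End Filtration.

Lemma limn_einf_eq0 (R : realType) (u : nat -> R) : (forall k, 0 <= u k) ->
  (forall e, 0 < e -> forall k0, exists2 k, (k0 <= k)%N & u k < e) ->
  limn_einf (fun k => (u k)%:E) = 0%E.
Proof.
move=> u0 small; rewrite limn_einf_lim; apply/eqP; rewrite eq_le; apply/andP; split.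
  apply/lee_addgt0Pr => e e0; rewrite add0e; apply: lime_le; first exact: is_cvg_einfs.
  apply: nearW => k0; have [k k0k uk] := small e e0 k0.
  apply: le_trans (_ : (u k)%:E <= _)%E; last by rewrite lee_fin ltW.
  by apply: ereal_inf_lbound; exists k.
apply: lime_ge; first exact: is_cvg_einfs.
by apply: nearW => k0; apply: le_ereal_inf_tmp => _ [k _ <-]; rewrite lee_fin.
Qed.

(** * The nonstationary regime does not last *)

Section Trapped.
Context {R : realType} {n : nat} (f : 'rV[R]_n -> R) (x0 : 'rV[R]_n).
Context (eta1 eta2 gamma dmax kfod delta0 : R).
Context (eta1_gt0 : 0 < eta1) (eta2_gt0 : 0 < eta2) (gamma_gt1 : 1 < gamma)
  (kfod_gt0 : 0 < kfod) (delta0_gt0 : 0 < delta0) (delta0_le : delta0 <= dmax)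
  (f_lb : exists b : R, forall x, levelset f x0 x -> b <= f x).
Context {d : measure_display} {T : measurableType d} (P : probability T R).
Context (M : nat -> T -> qmodel R n) (S X : nat -> T -> 'rV[R]_n)
  (Delta : nat -> T -> R).
Context (M_random : forall k, random_model (M k))
  (run : forall w, tr_run eta1 eta2 gamma dmax kfod f x0 delta0
     (X ^~ w) (Delta ^~ w) (M ^~ w) (S ^~ w))
  (X_past : forall k (i : 'I_n),
     measurable_wrt (past_events M k) (fun w => X k w 0 i))
  (Delta_past : forall k, measurable_wrt (past_events M k) (Delta k))
  (keh keg kef : R)
  (M_fq : prob_fully_quadratic P keh keg kef f M X Delta).

Let Delta_gt0 k w : 0 < Delta k w.
Proof. exact: (radius_gt0 gamma_gt1 delta0_gt0 delta0_le (run w)). Qed.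

Let Delta_le k w : Delta k w <= dmax.
Proof. exact: (radius_le gamma_gt1 delta0_gt0 delta0_le (run w)). Qed.

Let dmax_gt0 : 0 < dmax. Proof. exact: lt_le_trans delta0_le. Qed.

Let gamma_gt0 : 0 < gamma. Proof. exact: lt_trans gamma_gt1. Qed.

Let lngamma_gt0 : 0 < ln gamma. Proof. exact: ln_gt0. Qed.

(** Here C k is the event that the run has been in O with radius at most c from
    time k0 to time k0 + k.  On it, full quadraticity leads to acceptance and,
    since gamma * c <= dmax, to an increase of the radius by exactly the factor
    gamma; in all other cases the radius is divided by at most gamma. *)
Lemma trapped_null (O : set 'rV[R]_n) (c : R) (k0 : nat) : open O ->
  gamma * c <= dmax ->
  (forall x, O x -> forall delta m s, 0 < delta <= c ->
     fully_quadratic keh keg kef f m x delta ->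
     frac_optimal_decrease kfod m x delta s -> eball 0 delta s ->
     tr_accept eta1 eta2 f m x delta s) ->
  P.-negligible [set w | forall k, (k0 <= k)%N -> O (X k w) /\ Delta k w <= c].
Proof.
move=> oO gc accept.
pose B k : set T := X k @^-1` O `&` [set w | Delta k w <= c].
have subM k : <<s past_events M k >> `<=` measurable by exact: past_events_measurable.
have pB k : <<s past_events M k >> (B k).
  apply: (@measurableI _ (g_sigma_algebraType (past_events M k))).
    exact: open_preimage_wrt.
  rewrite (_ : [set w | _] = setT `&` Delta k @^-1` `]-oo, c]%classic).
    by apply: Delta_past.
  by apply/seteqP; split => w /=; rewrite in_itv /=; [|case].
pose C k : set T := \bigcap_(i < k.+1) B (k0 + i)%N.
have pC k : <<s past_events M (k0 + k)%N >> (C k).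
  apply: (@bigcap_measurableType _ (g_sigma_algebraType (past_events M (k0 + k)%N))).
  by move=> i ik; apply: (@past_events_le _ _ _ _ M (k0 + i)%N); rewrite ?leq_add2l.
pose E : set T := \bigcap_k C k.
have mE : measurable E by apply: bigcapT_measurable => k; exact: (subM _ _ (pC k)).
exists E; split => //; last first.
  by move=> w wE k _ i _; apply: wE; rewrite leq_addr.
have [p p_half M_fqp] := M_fq.
pose fq k := [set w | fully_quadratic keh keg kef f (M k w) (X k w) (Delta k w)].
have mfq k : measurable (fq k) by have [Z [? ? ? ?] _] := M_fqp k.
apply: (@supermartingale_escape _ _ _ P (ln gamma)
  (ln dmax - ln (delta0 * gamma^-1 ^+ k0))
  (fun k w => ln dmax - ln (Delta (k0 + k)%N w)) C (fun k => fq (k0 + k)%N)).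
- exact: lngamma_gt0.
- move=> k; apply: measurable_funB; first exact: measurable_cst.
  apply: measurableT_comp; first exact: measurable_ln.
  exact: (measurable_wrt_fun (subM _) (@Delta_past (k0 + k)%N)).
- by move=> k w; rewrite subr_ge0 ler_ln ?posrE.
- move=> w; rewrite lerD2l lerN2 addn0 ler_ln ?posrE//.
    exact: (radius_lower gamma_gt1 delta0_gt0 delta0_le (run w)).
  by rewrite mulr_gt0// exprn_gt0// invr_gt0.
- by move=> k; exact: (subM _ _ (pC k)).
- by move=> k w wC i ik; apply: wC; exact: ltnW.
- by move=> k; exact: mfq.
- move=> k; apply: (@le_trans _ _ (2%:E * (p%:E * P (C k)))%E).
    rewrite muleA -EFinM -[leLHS]mul1e lee_wpmul2r ?measure_ge0//.
    by rewrite lee_fin -ler_pdivrMl// mulr1.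
  rewrite lee_pmul2l//; apply: cond_prob_ge_le (M_fqp (k0 + k)%N) (pC k) => //.
  exact: le_trans p_half.
- move=> k w wC; have [Ow cw] := wC k (ltnSn k); rewrite addnS.
  have [_ _ /(_ (k0 + k)%N)[sk fod _ dE]] := run w.
  have D0 := Delta_gt0 (k0 + k)%N w; have D'0 := Delta_gt0 (k0 + k)%N.+1 w.
  rewrite indicE; have [fqw|nfqw] := boolP (w \in fq (k0 + k)%N).
    have acc : tr_accept eta1 eta2 f (M (k0 + k)%N w) (X (k0 + k)%N w)
        (Delta (k0 + k)%N w) (S (k0 + k)%N w).
      by apply: (accept _ Ow _ _ _ _ _ fod sk); [rewrite D0|exact: set_mem].
    rewrite acc min_l in dE; last by apply: le_trans gc; rewrite ler_pM2l.
    by rewrite dE lnM ?posrE//=; lra.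
  have Dle : Delta (k0 + k)%N w <= gamma * Delta (k0 + k)%N.+1 w.
    rewrite -ler_pdivrMl//.
    exact: (radius_ge_step gamma_gt1 delta0_gt0 delta0_le (run w)).
  have lnD : ln (Delta (k0 + k)%N w) <= ln gamma + ln (Delta (k0 + k)%N.+1 w).
    by rewrite -lnM ?posrE// ler_ln ?posrE ?mulr_gt0.
  by rewrite /=; lra.
- exact: mE.
- by move=> k w; apply.
- move=> w _; apply/cvgryPge => A; have [b fb] := f_lb.
  have := radius_cvg0 eta1_gt0 eta2_gt0 gamma_gt1 kfod_gt0 delta0_gt0 delta0_le (run w) fb.
  move=> /cvgr0Pnorm_lt/(_ (expR (ln dmax - A)) (expR_gt0 _))[N _ small].
  exists N => // k /= Nk; have /small : (N <= k0 + k)%N by rewrite (leq_trans Nk) ?leq_addl.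
  rewrite /= gtr0_norm// => Dk; rewrite lerBrDl -lerBrDr -[leRHS]expRK.
  by rewrite ler_ln ?posrE ?expR_gt0// ltW.
Qed.

End Trapped.

(** * Almost sure convergence *)

Theorem theorem5p1 (R : realType) (n : nat) (n_gt0 : (0 < n)%N)
    (f : 'rV[R]_n -> R) (x0 : 'rV[R]_n) (dmax : R) (dmax_gt0 : 0 < dmax)
    (fC2 : exists U : set 'rV[R]_n,
       [/\ open U, levelset_enl f x0 dmax `<=` U & C2_on U f])
    (kLh kbhf : R)
    (hess_lip : forall x y, levelset_enl f x0 dmax x ->
       levelset_enl f x0 dmax y ->
       opnorm (hessian f x - hessian f y) <= kLh * enorm (x - y))
    (hess_bnd : forall x, levelset_enl f x0 dmax x ->
       opnorm (hessian f x) <= kbhf)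
    (f_lb : exists b : R, forall x, levelset f x0 x -> b <= f x)
    (eta1 eta2 gamma kfod delta0 : R)
    (eta1_gt0 : 0 < eta1) (eta1_lt1 : eta1 < 1) (eta2_gt0 : 0 < eta2)
    (gamma_gt1 : 1 < gamma) (kfod_gt0 : 0 < kfod) (kfod_le1 : kfod <= 1)
    (delta0_gt0 : 0 < delta0) (delta0_le : delta0 <= dmax)
    (d : measure_display) (T : measurableType d) (P : probability T R)
    (M : nat -> T -> qmodel R n) (S : nat -> T -> 'rV[R]_n)
    (X : nat -> T -> 'rV[R]_n) (Delta : nat -> T -> R)
    (M_random : forall k, random_model (M k))
    (run : forall w : T, tr_run eta1 eta2 gamma dmax kfod f x0 delta0
       (fun k => X k w) (fun k => Delta k w)
       (fun k => M k w) (fun k => S k w))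
    (X_past : forall k (i : 'I_n),
       measurable_wrt (past_events M k) (fun w => X k w 0 i))
    (Delta_past : forall k, measurable_wrt (past_events M k) (Delta k))
    (keh keg kef : R)
    (keh_gt0 : 0 < keh) (keg_gt0 : 0 < keg) (kef_gt0 : 0 < kef)
    (M_fq : prob_fully_quadratic P keh keg kef f M X Delta) :
  {ae P, forall w, limn_einf (fun k => (tau f (X k w))%:E) = 0%E}.
Proof.
case: fC2 => U [oU LU C2f].
pose e j : R := j.+1%:R^-1.
have e_gt0 j : 0 < e j by rewrite invr_gt0.
(* From e j <= tau, one half is lost to the infimum in lambda_min and another
   to the passage to nearby points. *)
pose ns j := [set y | nonstationary (e j / 2 / 2) (gradient f y) (hessian f y)].
have accept j : exists2 c, 0 < c & gamma * c <= dmax /\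
    forall x, ns j x -> forall delta m s, 0 < delta <= c ->
      fully_quadratic keh keg kef f m x delta ->
      frac_optimal_decrease kfod m x delta s -> eball 0 delta s ->
      tr_accept eta1 eta2 f m x delta s.
  have ej : 0 < e j / 2 / 2 by rewrite !divr_gt0.
  have near_acc := near0_tr_accept f eta2 keh keg kef eta1_lt1 kfod_gt0 ej.
  have [r /= r0 small] : \forall c \near 0^'+, gamma * c <= dmax /\
      forall m x s, nonstationary (e j / 2 / 2) (gradient f x) (hessian f x) ->
        fully_quadratic keh keg kef f m x c -> frac_optimal_decrease kfod m x c s ->
        eball 0 c s -> tr_accept eta1 eta2 f m x c s.
    by apply: filterS2 near_acc (near0_linear_le gamma dmax_gt0).
  have r20 : 0 < r / 2 by rewrite divr_gt0.
  have r2r : r / 2 < r by rewrite ltr_pdivrMr// ltr_pMr// ltr1n.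
  have in_ball c : 0 < c -> c <= r / 2 -> ball (0 : R) r c.
    by move=> c0 cr; rewrite /ball /= sub0r normrN gtr0_norm// (le_lt_trans cr).
  exists (r / 2) => //; split; first by case: (small (r / 2) (in_ball _ r20 (lexx _)) r20).
  move=> x nsx delta m s /andP[d0 dr].
  by have [_] := small delta (in_ball _ d0 dr) d0; apply.
pose c j := s2val (cid2 (accept j)).
have null j k0 : P.-negligible
    [set w | forall k, (k0 <= k)%N -> (ns j)^° (X k w) /\ Delta k w <= c j].
  rewrite /c; case: cid2 => /= cj _ [gcj acc].
  apply: (trapped_null eta1_gt0 eta2_gt0 gamma_gt1 kfod_gt0 delta0_gt0 delta0_le
    f_lb M_random run X_past Delta_past M_fq) => //; first exact: open_interior.
  by move=> x /interior_subset; exact: acc.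
apply: negligibleS (negligible_bigcup (fun j => negligible_bigcup (null j))).
move=> w tauw; apply: contrapT => no_trap; apply: tauw.
apply: limn_einf_eq0 => [k|eps eps0 k0]; first exact: stat_measure_ge0.
apply: contrapT => no_small; apply: no_trap.
have [j _ /(_ j (leqnn j)) je] := near_infty_natSinv_lt (PosNum eps0).
have {}je : e j < eps by [].
have cj0 : 0 < c j by rewrite /c; case: cid2.
have [b fb] := f_lb.
have := radius_cvg0 eta1_gt0 eta2_gt0 gamma_gt1 kfod_gt0 delta0_gt0 delta0_le (run w) fb.
move=> /cvgr0Pnorm_lt/(_ (c j) cj0)[k1 _ small].
exists j => //; exists (maxn k0 k1) => // k; rewrite geq_max => /andP[k0k k1k].
split; last by rewrite ltW// (le_lt_trans (ler_norm _))//; exact: small.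
have LX : levelset f x0 (X k w).
  exact: (run_levelset eta1_gt0 eta2_gt0 gamma_gt1 kfod_gt0 delta0_gt0 delta0_le (run w)).
have UX : U (X k w).
  by apply: LU; exists (X k w) => //; rewrite /eball /= subrr enorm0 ltW.
have [_ dg cH] := C2f _ UX.
apply: (near_nonstationary (g := gradient f) (H := hessian f)) => //.
- by rewrite divr_gt0.
- exact: differentiable_continuous.
- have ej2 : e j / 2 < e j by rewrite ltr_pdivrMr// ltr_pMr// ltr1n.
  apply: nonstationary_of_stat_measure ej2 _; first by rewrite divr_ge0// ltW.
  rewrite leNgt; apply/negP => tauX; apply: no_small.
  by exists k => //; exact: lt_trans je.
Qed.
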